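(* Let $G$ be a connected graph on $n\ge 4$ vertices. Then $\overline{\gamma_P}(G)\le n-2$. Furthermore, $\overline{\gamma_P}(G)=n-2$ if and only if $G$ is (isomorphic to) the star $K_{1,n-1}$.
   Context: Graphs are finite and simple. For a graph $G$ and a non-empty $S\subseteq V(G)$ define $P^0[S]=S$, $P^1[S]=N[S]$ (the union of the closed neighborhoods of vertices of $S$), and for $i\ge 2$, $P^i[S]=P^{i-1}[S]\cup\{u: N_G(v)\setminus P^{i-1}[S]=\{u\}\text{ for some }v\in P^{i-1}[S]\}$. $S$ is a power dominating set if $P^t[S]=V(G)$ for some $t$. The upper power domination number $\overline{\gamma_P}(G)$ is the maximum cardinality of a minimal (with respect to inclusion) power dominating set of $G$. *)

(* Defs.v *)
From mathcomp Require Import all_boot.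
From mathcomp Require Import boolp.

Set Implicit Arguments.
Unset Strict Implicit.
Unset Printing Implicit Defensive.

Record sgraph := SGraph {
  vertex :> finType;
  adj : rel vertex;
  adj_sym : symmetric adj;
  adj_irrefl : irreflexive adj
}.

Definition connected_graph (G : sgraph) : Prop :=
  forall x y : G, connect (@adj G) x y.

Definition graph_iso (G H : sgraph) : Prop :=
  exists2 f : G -> H, bijective f & forall x y : G, adj (f x) (f y) = adj x y.

Section CompleteBipartite.
Variables p q : nat.

Definition bip_adj (x y : 'I_p + 'I_q) : bool :=
  match x, y with
  | inl _, inr _ | inr _, inl _ => true
  | _, _ => false
  end.

Lemma bip_adj_sym : symmetric bip_adj.
Proof. by case=> ? []. Qed.

Lemma bip_adj_irrefl : irreflexive bip_adj.
Proof. by case. Qed.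

Definition complete_bipartite : sgraph := SGraph bip_adj_sym bip_adj_irrefl.
End CompleteBipartite.

Section PowerDomination.
Variable G : sgraph.
Implicit Types (S P : {set G}) (v : G).

Definition neighborhood v : {set G} := [set u | adj v u].

Definition closed_neighborhood v : {set G} := v |: neighborhood v.

Definition set_closed_neighborhood S : {set G} :=
  \bigcup_(v in S) closed_neighborhood v.

Definition propagate P : {set G} :=
  P :|: [set u | [exists v in P, neighborhood v :\: P == [set u]]].

Fixpoint observed (i : nat) S : {set G} :=
  match i with
  | 0 => S
  | 1 => set_closed_neighborhood S
  | j.+1 => propagate (observed j S)
  end.

Definition power_dominating : pred {set G} :=
  fun S => (S != set0) && `[< exists t, observed t S = [set: G] >].

Definition minimal_power_dominating : pred {set G} := minset power_dominating.

(* A graph with at least one vertex has a minimal power dominating set, so the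
   default value 0 of [\max] is only reached on the graph without vertices. *)
Definition upper_power_domination_number : nat :=
  \max_(S : {set G} | minimal_power_dominating S) #|S|.
End PowerDomination.

(* Main.v *)
Require Import Defs.
From mathcomp Require Import all_boot.
From mathcomp Require Import boolp.
From mathcomp Require Import perm.

(** Write [n] for the number of vertices. Failure of power domination is
    witnessed by a fort: a non-empty set [F] such that no vertex outside [F]
    has exactly one neighbour in [F]. A vertex of a fort can only be observed
    by direct domination, since a forcing vertex outside [F] would need a
    unique neighbour in [F]; and whatever remains unobserved when the
    propagation stalls is a fort. So a set power dominates if and only if its
    closed neighbourhood meets every fort ([power_dominating_fort]).

    In a connected graph a fort [F] missed by [N[T]] is joined by an edge to
    some vertex [a] outside it, and then [a] has at least two neighbours [b],
    [c] in [F]; none of the three is in [T] ([unobserved_fork]). Hence a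
    non-empty set that misses at most two vertices power dominates, and a
    minimal power dominating set has at most [n - 2] vertices, for otherwise
    it could lose one of them.

    Let [S] be minimal with exactly [n - 2] vertices, the other two being [x]
    and [y]. For each [z] in [S] the set [S :\ z] fails and misses only
    [{x, y, z}], so these three vertices are the fork: one of them is adjacent
    to the other two, which have no neighbour outside the triple. Comparing
    the triples for different [z], the middle of the fork cannot be [z] and
    cannot change from [x] to [y]; so it is the same vertex throughout, and
    that vertex is the centre of a star ([big_minimal_star]). Conversely,
    in a star any two leaves form a fort, which makes the complement of the
    centre and one leaf minimal ([star_minimal]). *)

Set Implicit Arguments.
Unset Strict Implicit.
Unset Printing Implicit Defensive.

(** * Power domination and forts *)

Section Forts.
Variable G : sgraph.
Implicit Types (S T P F : {set G}) (a b c u v w x y z : G).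

Lemma in_closed_neighborhood T u :
  (u \in set_closed_neighborhood T) =
  (u \in T) || [exists v in T, adj v u].
Proof.
apply/bigcupP/orP => [[v vT]|[uT|/'exists_andP[v [vT vu]]]].
- rewrite !inE => /predU1P[->|vu]; first by left.
  by right; apply/'exists_andP; exists v.
- by exists u => //; rewrite !inE eqxx.
- by exists v => //; rewrite !inE vu orbT.
Qed.

Lemma sub_closed_neighborhood T : T \subset set_closed_neighborhood T.
Proof. by apply/subsetP => u uT; rewrite in_closed_neighborhood uT. Qed.

Definition fort F : bool :=
  (F != set0) && [forall v in ~: F, #|neighborhood v :&: F| != 1].

Lemma disjoint_propagate F P :
  fort F -> [disjoint P & F] -> [disjoint propagate P & F].
Proof.
move=> /andP[_ /forall_inP fortF] dPF; rewrite -setI_eq0.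
apply/eqP/setP => u; rewrite !inE; apply/negP => /andP[/orP[uP|forced] uF].
  by rewrite (disjointFr dPF uP) in uF.
case/exists_inP: forced => v vP /eqP only_u.
have vF : v \in ~: F by rewrite inE (disjointFr dPF vP).
have /negP[] := fortF v vF; apply/cards1P; exists u.
apply/setP => w; rewrite inE.
have := congr1 (fun A : {set G} => w \in A) only_u; rewrite !inE => <-.
case wF: (w \in F); first by rewrite (disjointFl dPF wF) andbT.
rewrite andbF; apply/esym/negP => w_new.
have : w \in [set u] by rewrite -only_u !inE.
by rewrite inE => /eqP wu; rewrite wu uF in wF.
Qed.

(** The observed sets cannot grow forever. The index starts at one because the
    first step is domination, not propagation. *)
Lemma observed_stalls T :
  exists t, propagate (observed t.+1 T) = observed t.+1 T.
Proof.
apply: contrapT => grows.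
have size_t t : t <= #|observed t.+1 T|.
  elim: t => // t IH; apply: leq_ltn_trans IH _; apply: proper_card.
  rewrite properEneq subsetUl andbT.
  by apply/eqP => stall; apply: grows; exists t.
by have := leq_trans (size_t #|G|.+1) (max_card _); rewrite ltnn.
Qed.

Lemma closed_neighborhood_observed T t :
  set_closed_neighborhood T \subset observed t.+1 T.
Proof. by elim: t => // t IH; apply: subset_trans IH (subsetUl _ _). Qed.

Lemma stalled_fort P : P != setT -> propagate P = P -> fort (~: P).
Proof.
move=> PT stall; apply/andP; split.
  by apply: contra PT => /eqP P0; rewrite -(setCK P) P0 setC0.
apply/forall_inP => v; rewrite setCK => vP; apply/negP => /cards1P[u only_u].
have uP : u \in P.
  rewrite -stall !inE; apply/orP; right; apply/exists_inP; exists v => //.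
  by rewrite setDE only_u.
have : u \in neighborhood v :&: ~: P by rewrite only_u set11.
by rewrite !inE uP andbF.
Qed.

(** Propagation never enters a fort from outside, and it stalls only on the
    complement of a fort. *)
Lemma power_dominating_fort T :
  T != set0 ->
  power_dominating T <->
  (forall F, fort F -> ~~ [disjoint set_closed_neighborhood T & F]).
Proof.
move=> T0; split=> [/andP[_ /asboolP[t obs_t]] F fortF|meets].
  apply/negP => dTF.
  have dis s : [disjoint observed s T & F].
    case: s => [|s]; first exact: disjointWl (sub_closed_neighborhood T) dTF.
    by elim: s => // s IH; apply: disjoint_propagate.
  have := dis t; rewrite obs_t -setI_eq0 setTI => F0.
  by case/andP: fortF; rewrite F0.
rewrite /power_dominating T0; apply/asboolP.
have [t stall] := observed_stalls T; exists t.+1; apply/eqP.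
apply: contraT => /stalled_fort/(_ stall)/meets/negP[].
apply: disjointWl (closed_neighborhood_observed T t) _.
by rewrite disjoints_subset setCK.
Qed.

Lemma connected_boundary F u v :
  connected_graph G -> u \notin F -> v \in F ->
  exists a b, [/\ adj a b, a \notin F & b \in F].
Proof.
move=> conn uF vF; apply: contrapT => no_edge.
have cF : closed (@adj G) F.
  move=> a b ab; case aF: (a \in F); case bF: (b \in F) => //;
    exfalso; apply: no_edge.
  - by exists b, a; rewrite (adj_sym b a) bF.
  - by exists a, b; rewrite aF.
by move: uF; rewrite (closed_connect cF (conn u v)) vF.
Qed.

(** The fork is an edge [a b] leaving the complement of a missed fort: since
    [a] has one neighbour in the fort, it has a second one, [c]. *)
Lemma unobserved_fork T :
  connected_graph G -> T != set0 -> ~~ power_dominating T ->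
  exists a b c, [/\ adj a b, adj a c, b != c &
    [/\ a \notin T, b \notin set_closed_neighborhood T &
        c \notin set_closed_neighborhood T]].
Proof.
move=> conn T0 /negP nPD.
have [F [fortF dTF]] : exists F, fort F /\
    [disjoint set_closed_neighborhood T & F].
  apply: contrapT => noF; apply: nPD; apply/(power_dominating_fort T0) => F fF.
  by apply/negP => dF; apply: noF; exists F.
have [F0 /forall_inP fort_out] := andP fortF.
have [[t tT] [f fF]] := (set0Pn _ T0, set0Pn _ F0).
have tF : t \notin F.
  by rewrite (disjointFr dTF) // (subsetP (sub_closed_neighborhood T)).
have [a [b [ab aF bF]]] := connected_boundary conn tF fF.
have : 1 < #|neighborhood a :&: F|.
  rewrite ltn_neqAle eq_sym fort_out ?inE //=.
  by apply/card_gt0P; exists b; rewrite !inE ab.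
rewrite (cardsD1 b) !inE ab bF ltnS => /card_gt0P[c].
rewrite !inE => /and3P[cb ac cF]; exists a, b, c.
rewrite eq_sym cb; split=> //; rewrite !(disjointFl dTF) //; split=> //.
apply/negP => aT; have /negP[] := negbT (disjointFl dTF bF).
by rewrite in_closed_neighborhood; apply/orP; right; apply/exists_inP; exists a.
Qed.

Lemma unobserved_neighbor T u w :
  u \notin set_closed_neighborhood T -> adj u w -> w \notin T.
Proof.
rewrite in_closed_neighborhood negb_or => /andP[_ /exists_inPn no_nb] uw.
by apply/negP => /no_nb; rewrite adj_sym uw.
Qed.

(** When [T] misses only three vertices, the fork consists of all of them. *)
Lemma unobserved_fork_card T :
  connected_graph G -> T != set0 -> ~~ power_dominating T ->
  2 < #|~: T| /\
  (#|~: T| = 3 -> exists2 a, a \notin T &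
     forall b, b \notin T -> b != a ->
       adj a b /\ forall w, adj b w -> w \notin T).
Proof.
move=> conn T0 nPD.
have [a [b [c [ab ac bc [aT bN cN]]]]] := unobserved_fork conn T0 nPD.
have neq u v : adj u v -> u != v.
  by apply: contraTneq => ->; rewrite adj_irrefl.
have outT u : u \notin set_closed_neighborhood T -> u \notin T.
  by apply: contra; apply/subsetP/sub_closed_neighborhood.
have card_abc : #|[set a; b; c]| = 3.
  by rewrite setUC cardsU1 cards2 !inE negb_or !(eq_sym c) neq // bc neq.
have sub_abc : [set a; b; c] \subset ~: T.
  by apply/subsetP => u; rewrite !inE => /orP[/orP[]|] /eqP-> //; apply: outT.
split=> [|card_T]; first by rewrite -card_abc subset_leq_card.
have /eqP eq_abc : [set a; b; c] == ~: T.
  by rewrite eqEcard sub_abc card_T card_abc.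
exists a => // d; rewrite -in_setC -eq_abc !inE => /orP[/orP[/eqP->|/eqP->]|/eqP->].
- by rewrite eqxx.
- by split=> // w; apply: unobserved_neighbor.
- by split=> // w; apply: unobserved_neighbor.
Qed.

End Forts.

(** * Minimal power dominating sets and stars *)

Definition star_at (G : sgraph) (x : G) : Prop :=
  forall u v : G, adj u v = (u == x) (+) (v == x).

Section Stars.
Variable G : sgraph.
Implicit Types (S : {set G}) (a b u v w x y z : G).

Lemma minimal_power_dominatingD1 S z :
  minimal_power_dominating S -> z \in S -> ~~ power_dominating (S :\ z).
Proof.
move=> /minsetP[_ minS] zS; apply/negP => /minS/(_ (subD1set _ _)) eqS.
by move: zS; rewrite -eqS !inE eqxx.
Qed.

Lemma minimal_fork S z :
  connected_graph G -> minimal_power_dominating S -> 1 < #|S| -> z \in S ->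
  1 < #|~: S| /\
  (#|~: S| = 2 -> exists2 a, a \notin S :\ z &
     forall b, b \notin S :\ z -> b != a ->
       adj a b /\ forall w, adj b w -> w \notin S :\ z).
Proof.
move=> conn minS S1 zS.
have Sz0 : S :\ z != set0.
  by rewrite -card_gt0; move: S1; rewrite (cardsD1 z) zS.
have := unobserved_fork_card conn Sz0 (minimal_power_dominatingD1 minS zS).
have -> : #|~: (S :\ z)| = #|~: S|.+1.
  by rewrite setCD setUC cardsU1 inE zS.
by case=> big fork; split=> // C2; apply: fork; rewrite C2.
Qed.

(** The middle [a] of the fork for [z] lies outside [S]: were it [z], all
    neighbours in [S] of the vertices outside [S] would be [z], while the fork
    for any other [z'] in [S] joins [z'] to a vertex outside [S]. The middle
    for [z1], adjacent to [z1], is then the middle for every other [z], as the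
    other two vertices of the fork for [z] are not adjacent to [z1]. *)
Lemma big_minimal_star S :
  connected_graph G -> minimal_power_dominating S -> 1 < #|S| -> #|~: S| = 2 ->
  exists x, star_at x.
Proof.
move=> conn minS S1 C2.
pose middle z a := forall b, b \notin S :\ z -> b != a ->
  adj a b /\ forall w, adj b w -> w \notin S :\ z.
have fork z : z \in S -> exists2 a, a \notin S :\ z & middle z a.
  by move=> zS; have [_ /(_ C2)] := minimal_fork conn minS S1 zS.
have outS z b : b \notin S -> b \notin S :\ z.
  by move=> bS; rewrite !inE (negbTE bS) andbF.
have outz z : z \notin S :\ z by rewrite !inE eqxx.
have inS z w : w \notin S :\ z -> w \in S -> w = z.
  by rewrite !inE negb_and negbK => /orP[/eqP//|/negbTE->].
have /card_gt1P[z1 [z2 [z1S z2S z12]]] := S1.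
have other z : exists2 z', z' \in S & z' != z.
  have [<-|] := eqVneq z1 z; last by exists z1.
  by exists z2 => //; rewrite eq_sym.
have outside z : z \in S -> exists2 x, x \notin S & adj x z.
  move=> zS; have [a aSz mid] := fork z zS.
  have [aS|aS] := boolP (a \in S).
    have az := inS _ _ aSz aS; rewrite {}az {a aSz aS} in mid.
    have /card_gt0P[x] : 0 < #|~: S| by rewrite C2.
    rewrite inE => xS; exists x => //; rewrite adj_sym.
    by apply: (mid x (outS z x xS) _).1; apply: contraNneq xS => ->.
  exists a => //; apply: (mid z (outz z) _).1.
  by apply: contraNneq aS => <-.
have mid_out z : z \in S -> exists2 a, a \notin S & middle z a.
  move=> zS; have [a aSz mid] := fork z zS; exists a => //.
  apply/negP => aS; have az := inS _ _ aSz aS; rewrite {}az {a aSz aS} in mid.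
  have [z' z'S z'z] := other z; have [x xS xz'] := outside z' z'S.
  have xz : x != z by apply: contraNneq xS => ->.
  have [_ /(_ z' xz')] := mid x (outS z x xS) xz.
  by move/inS/(_ z'S)/eqP; rewrite (negbTE z'z).
have [x xS mid1] := mid_out z1 z1S; exists x.
have neqx z : z \in S -> z != x by apply: contraTneq => ->.
have mid z : z \in S -> middle z x.
  move=> zS; have [<-//|z1z] := eqVneq z1 z.
  have [a aS mida] := mid_out z zS.
  have [->//|xa] := eqVneq x a.
  have [_ near_x] := mida x (outS z x xS) xa.
  have [xz1 _] := mid1 z1 (outz z1) (neqx z1 z1S).
  by move: z1z; rewrite (inS _ _ (near_x z1 xz1) z1S) eqxx.
have adjx u : u != x -> adj x u.
  move=> ux; have [uS|uS] := boolP (u \in S).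
    exact: (mid u uS u (outz u) ux).1.
  exact: (mid1 u (outS z1 u uS) ux).1.
have leaf_in u v : u \in S -> v != x -> ~~ adj u v.
  move=> uS vx; apply/negP => uv.
  have := (mid u uS u (outz u) (neqx u uS)).2 v uv => vSu.
  have [vS|vS] := boolP (v \in S).
    by move: uv; rewrite (inS _ _ vSu vS) adj_irrefl.
  rewrite adj_sym in uv.
  have u_is z : z \in S -> u = z.
    by move=> zS; apply: inS uS; apply: (mid z zS v (outS z v vS) vx).2.
  by move: z12; rewrite -(u_is z1 z1S) -(u_is z2 z2S) eqxx.
move=> u v; have [->|ux] := eqVneq u x; have [->|vx] := eqVneq v x => /=.
- exact: adj_irrefl.
- exact: adjx.
- by rewrite adj_sym adjx.
have [uS|uS] := boolP (u \in S); first exact/negbTE/leaf_in.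
have [vS|vS] := boolP (v \in S); first by rewrite adj_sym; apply/negbTE/leaf_in.
(* Outside [S] there is only one vertex besides [x]. *)
have [->|uv] := eqVneq u v; first exact: adj_irrefl.
have : #|[set x; u; v]| <= #|~: S|.
  apply/subset_leq_card/subsetP => w; rewrite !inE.
  by case/orP=> [/orP[]|] /eqP->.
by rewrite C2 setUC cardsU1 cards2 !inE negb_or vx !(eq_sym _ u) uv ux.
Qed.

Lemma leaves_fort x y z :
  star_at x -> y != x -> z != x -> y != z -> fort [set y; z].
Proof.
move=> star yx zx yz; apply/andP; split.
  by apply/set0Pn; exists y; rewrite set21.
apply/forall_inP => v; rewrite !inE negb_or => /andP[vy vz].
have [->|vx] := eqVneq v x.
  suff -> : neighborhood x :&: [set y; z] = [set y; z] by rewrite cards2 yz.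
  apply/setIidPr/subsetP => w; rewrite !inE star eqxx.
  by case/orP=> /eqP->; rewrite ?(negbTE yx) ?(negbTE zx).
suff -> : neighborhood v :&: [set y; z] = set0 by rewrite cards0.
apply/setP => w; rewrite !inE star (negbTE vx) /=.
apply/negP => /andP[/eqP-> /orP[]] /eqP xE.
  by rewrite xE eqxx in yx.
by rewrite xE eqxx in zx.
Qed.

(** The set power dominates because it misses only two vertices. A subset of it
    omitting a further leaf [z] does not contain [x], so its closed
    neighbourhood misses the fort [[set y; z]]. *)
Lemma star_minimal x y :
  connected_graph G -> 2 < #|G| -> star_at x -> y != x ->
  minimal_power_dominating (~: [set x; y]).
Proof.
move=> conn G3 star yx.
have S0 : ~: [set x; y] != set0.
  rewrite -card_gt0 -(ltn_add2l #|[set x; y]|) cardsC addn0.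
  by rewrite cards2 eq_sym yx.
apply/minsetP; split=> [|B PB sub].
  apply: contraT => /(unobserved_fork_card conn S0)[+ _].
  by rewrite setCK cards2; case: (x != y).
apply/eqP; rewrite eqEsubset sub /=; apply/subsetP => z.
rewrite !inE negb_or => /andP[zx zy]; apply: contraT => zB.
have B0 : B != set0 by case/andP: PB.
have /(_ [set y; z]) := (power_dominating_fort B0).1 PB.
rewrite (leaves_fort star yx zx) 1?eq_sym // => /(_ isT)/negP[].
have notx w : w \in B -> (w != x) && (w != y).
  by move=> /(subsetP sub); rewrite !inE negb_or.
rewrite -setI_eq0; apply/eqP/setP => w; rewrite [w \in set0]inE inE.
rewrite in_closed_neighborhood; apply/negP => /andP[near].
have wx : w \in [set y; z] -> w != x by rewrite !inE => /orP[] /eqP->.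
move=> wyz; case/orP: near => [wB|/exists_inP[v vB]].
  by move: wyz; rewrite !inE (negbTE (andP (notx w wB)).2) => /eqP wz;
     rewrite -wz wB in zB.
by rewrite star (negbTE (wx wyz)) (negbTE (andP (notx v vB)).1).
Qed.

End Stars.

(** * Stars up to isomorphism *)

Lemma star_iso (G H : sgraph) (x : G) (x' : H) :
  #|G| = #|H| -> star_at x -> star_at x' -> graph_iso G H.
Proof.
move=> GH starx starx'.
pose h (u : G) : H := enum_val (cast_ord GH (enum_rank u)).
have h_inj : injective h.
  by move=> u v /enum_val_inj/cast_ord_inj/enum_rank_inj.
(* A bijection between the vertices, corrected so as to match the centres. *)
pose f (u : G) := tperm (h x) x' (h u).
have f_inj : injective f by move=> u v /perm_inj/h_inj.
exists f; first by apply: inj_card_bij; rewrite ?GH.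
have f_centre u : (f u == x') = (u == x).
  have <- : f x = x' by rewrite /f tpermL.
  exact: inj_eq.
by move=> u v; rewrite starx' starx !f_centre.
Qed.

Lemma complete_bipartite_star q : @star_at (complete_bipartite 1 q) (inl ord0).
Proof.
have inlE (i : 'I_1) : (inl i == inl ord0 :> 'I_1 + 'I_q) by rewrite [i]ord1.
by case=> i [] j; rewrite /= ?inlE.
Qed.

Lemma iso_star_at (G H : sgraph) (x' : H) :
  graph_iso G H -> star_at x' -> exists x : G, star_at x.
Proof.
move=> [f [g fK gK] f_adj] star; exists (g x') => u v.
by rewrite -f_adj star !(can2_eq fK gK).
Qed.

Lemma graph_iso_starP (G : sgraph) :
  0 < #|G| ->
  (exists x : G, star_at x) <-> graph_iso G (complete_bipartite 1 (#|G| - 1)).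
Proof.
move=> G0; split=> [[x star]|iso].
  apply: (star_iso _ star (@complete_bipartite_star _)).
  by rewrite card_sum !card_ord subnKC.
exact: iso_star_at iso (@complete_bipartite_star _).
Qed.

Theorem proposition3p13 (G : sgraph) (n : nat) (Gn : #|G| = n) (n_ge4 : 4 <= n)
    (G_conn : connected_graph G) :
  upper_power_domination_number G <= n - 2 /\
  (upper_power_domination_number G = n - 2 <->
   graph_iso G (complete_bipartite 1 (n - 1))).
Proof.
have bound (S : {set G}) : minimal_power_dominating S -> #|S| <= n - 2.
  move=> minS; have [S1|S1] := leqP #|S| 1.
    by rewrite (leq_trans S1) // leq_subRL // ltnW // ltnW.
  have /card_gt0P[z zS] := ltnW S1.
  have [C1 _] := minimal_fork G_conn minS S1 zS.
  by rewrite -Gn -(cardsC S) -addnBA // leq_addr.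
have upper : upper_power_domination_number G <= n - 2 by apply/bigmax_leqP.
split=> //; rewrite -{2}Gn -graph_iso_starP ?Gn; last exact: leq_trans n_ge4.
have n2 : 1 < n - 2 by rewrite ltn_subRL.
split=> [eq_upper|[x star]].
  apply: contrapT => no_star.
  suff : upper_power_domination_number G <= (n - 2).-1.
    by rewrite eq_upper -ltnS prednK ?ltnn // ltnW.
  apply/bigmax_leqP => S minS; rewrite -ltnS prednK ?(ltnW n2) //.
  rewrite ltn_neqAle bound // andbT; apply/eqP => S_big; apply: no_star.
  apply: (big_minimal_star G_conn minS); rewrite ?S_big //.
  by apply/eqP; rewrite -(eqn_add2l #|S|) cardsC S_big Gn subnK // ltnW // ltnW.
have /card_gt0P[y] : 0 < #|[set~ x]|.
  by rewrite cardsC1 Gn -ltnS prednK ltnW // ltnW // ltnW.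
rewrite !inE => yx; apply/eqP; rewrite eqn_leq upper /=.
have -> : n - 2 = #|~: [set x; y]| by rewrite cardsCs setCK cards2 eq_sym yx Gn.
by apply: leq_bigmax_cond; apply: star_minimal; rewrite ?Gn // ltnW.
Qed.
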